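(* In the setting described in the context, there is a constant $B\ge1$ depending only on the group $\Gamma$ (and the fixed norm $\|\cdot\|$) such that for every $T$ and all $\gamma_1,\gamma_2\in\Gamma_0$, if $\gamma_1(1)$ and $\gamma_2(1)$ are neighbors in $\mathcal{A}_{T,\partial\mathbb{D}}$, then $$\frac1B\|\gamma_2\|\le\|\gamma_1\|\le B\|\gamma_2\|.$$
   Context: Let $\mathbb{D}$ be the open unit disk in $\mathbb{C}$ (Poincaré disk, metric $ds^2=4(dx^2+dy^2)/(1-x^2-y^2)^2$), with boundary circle $\partial\mathbb{D}$. Let $C_1,C_2,C_3$ be Euclidean circles (none a line through $0$) orthogonal to $\partial\mathbb{D}$ and non-intersecting, let $\rho_i$ be the reflection (circle inversion) in $C_i$, and let $\Gamma_0=\langle\rho_1,\rho_2,\rho_3\rangle$. Each $C_i$ divides $\partial\mathbb{D}$ into a major arc $\mathfrak{M}_i$ and a minor arc $\mathfrak{m}_i$; $D_i$ is the region of $\mathbb{D}$ bounded by $C_i$ and $\mathfrak{m}_i$. The region $\mathcal{F}\subset\mathbb{D}$ bounded by $C_1,C_2,C_3$ is a fundamental domain for $\Gamma_0$; it has infinite hyperbolic area and is assumed principal: $|\rho_1'|,|\rho_2'|,|\rho_3'|\le 1$ on $\mathcal{F}$ (so $\mathcal{F}$ is the part of $\mathbb{D}$ outside all three circles and the $D_i$ are pairwise disjoint). The Euclidean distances $d_E(D_i,D_j)=\inf\{|x-y|: x\in D_i,y\in D_j\}$, $i\ne j$, are positive. The point $1\in\partial\mathbb{D}$ lies in the open arc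 of $\partial\mathbb{D}$ between $C_1$ and $C_3$ bordering $\mathcal{F}$. Let $\Gamma$ be the index-2 orientation-preserving subgroup generated by $\rho_1\rho_2,\rho_1\rho_3$. Norm: let $C_I$ be the Euclidean circle with center $1-r_0$ and radius $r_0>0$ (tangent to $\partial\mathbb{D}$ at $1$), with $r_0$ chosen so that $C_I\subset\mathcal{F}\cup\{1\}$ and $r_0<\frac13\min_{i\neq j}d_E(D_i,D_j)$. For $\gamma\in\Gamma_0$, $\gamma(C_I)$ is a circle of some radius $r_\gamma$ tangent to $\partial\mathbb{D}$ at $\gamma(1)$, and $\|\gamma\|^2:=1/r_\gamma$. $\mathcal{A}_{T,\partial\mathbb{D}}$ is the finite set $\{\gamma(1):\gamma\in\Gamma_0,\ \|\gamma\|<T\}\subset\partial\mathbb{D}$ in counterclockwise (cyclic) order; two points of it are neighbors if they are consecutive in this cyclic order. *)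

(* Defs.v *)
From HB Require Import structures.
From mathcomp Require Import all_boot all_order all_algebra.
From mathcomp Require Import all_classical all_reals all_analysis.
From mathcomp Require Import complex.

Set Implicit Arguments.
Unset Strict Implicit.
Unset Printing Implicit Defensive.

Import Order.TTheory GRing.Theory Num.Theory.
Import numFieldNormedType.Exports.

Local Open Scope classical_set_scope.
Local Open Scope complex_scope.
Local Open Scope ring_scope.

(* The norm `|z| of R[i] has values in R[i]; normc is the real-valued modulus.
   The topology of the plane is the one carried by R[i]^o. *)
Notation normc := ComplexField.Normc.normc.

Section Plane.
Variable R : realType.
Local Notation C := (R[i]).

Definition circle (c : C) (r : R) : set C := [set z | normc (z - c) = r].

Definition unit_disk : set C := [set z | normc z < 1].

Definition unit_circle : set C := circle 0 1.

(* The circles meet, and at each common point their radii (equivalently, their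
   tangent lines) are perpendicular. *)
Definition orthogonal_circles (c1 : C) (r1 : R) (c2 : C) (r2 : R) : Prop :=
  circle c1 r1 `&` circle c2 r2 !=set0 /\
  forall z, circle c1 r1 z -> circle c2 r2 z ->
    complex.Re ((z - c1) * (z - c2)^*) = 0.

(* Since 0^-1 = 0, the center c is sent to itself instead of infinity; for a
   circle orthogonal to the unit circle, c is outside the closed unit disk,
   which inversion maps bijectively to itself. *)
Definition inversion (c : C) (r : R) : C -> C :=
  fun z => c + (r ^+ 2)%:C / (z - c)^*.

(* The modulus |f'(z)| of the derivative, which makes sense for holomorphic as
   well as for antiholomorphic f. *)
Definition abs_deriv (f : C -> C) (z : C) : R :=
  lim ((fun w : C => normc (f w - f z) / normc (w - z)) @ (z : C^o)^').

Inductive generated (S : set (C -> C)) : (C -> C) -> Prop :=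
| generated_in f : S f -> generated S f
| generated_id : generated S id
| generated_comp f g : generated S f -> generated S g -> generated S (f \o g)
| generated_inv f g :
    generated S f -> cancel f g -> cancel g f -> generated S g.

(* Infimum of the Euclidean distances between points of A and B. *)
Definition edist (A B : set C) : R :=
  inf [set normc (x - y) | x in A & y in B].

Definition cis (t : R) : C := cos t +i* sin t.

(* Points met strictly between a and b when the unit circle is traversed
   counterclockwise from a to b; for b = a, one full turn is made. *)
Definition ccw_arc (a b : C) : set C :=
  [set z | exists s t : R,
    [/\ 0 < s <= 2 * pi, b = a * cis s, 0 < t < s & z = a * cis t]].

(* x and y are consecutive in the cyclic order of A (a subset of the unit
   circle), one way round or the other. *)
Definition neighbors (A : set C) (x y : C) : Prop :=
  [/\ A x, A y &
      ccw_arc x y `&` A = set0 \/ ccw_arc y x `&` A = set0].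

(* The radius of S if S is a circle, and 0 otherwise. *)
Definition radius (S : set C) : R :=
  xget 0 [set r | 0 < r /\ exists c, S = circle c r].

Section ReflectionGroup.
Variables (c : 'I_3 -> C) (r : 'I_3 -> R).

Definition mirror (i : 'I_3) : set C := circle (c i) (r i).

Definition rho (i : 'I_3) : C -> C := inversion (c i) (r i).

Definition Gamma0 : (C -> C) -> Prop := generated (range rho).

(* A mirror orthogonal to the unit circle has the origin in its exterior and
   cuts out the minor arc with its interior, so the side of the mirror bounded
   by the minor arc is its interior. *)
Definition minor_side (i : 'I_3) : set C :=
  unit_disk `&` [set z | normc (z - c i) < r i].

(* F is the component of the disk minus the mirrors that has all three mirrors
   on its boundary. *)
Definition region_bounded_by_mirrors (F : set C) : Prop :=
  (exists2 x, F x &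
     F = connected_component
           ((unit_disk `\` \bigcup_i mirror i) : set C^o) x) /\
  forall i, mirror i `&` unit_disk `<=` closure (F : set C^o).

(* The open arc with one end on mirror i and the other on mirror j, in the
   boundary of F. *)
Definition free_arc (F : set C) (i j : 'I_3) (A : set C) : Prop :=
  exists a b : C,
    [/\ unit_circle a /\ unit_circle b,
        (mirror i a /\ mirror j b) \/ (mirror j a /\ mirror i b),
        A = ccw_arc a b,
        A `&` \bigcup_k mirror k = set0 &
        A `<=` closure (F : set C^o)].

Record principal_configuration (F : set C) : Prop := PrincipalConfiguration {
  radii_gt0 : forall i, 0 < r i ;
  mirrors_orthogonal : forall i, orthogonal_circles 0 1 (c i) (r i) ;
  mirrors_disjoint : forall i j, i != j -> mirror i `&` mirror j = set0 ;
  region_bounded : region_bounded_by_mirrors F ;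
  principal_region : forall i z, F z -> abs_deriv (rho i) z <= 1 ;
  minor_sides_apart :
    forall i j, i != j -> 0 < edist (minor_side i) (minor_side j) ;
  one_in_free_arc :
    exists2 A, free_arc F ord0 ord_max A & A 1
}.

(* The circle C_I, internally tangent to the unit circle at 1. *)
Definition horocycle (r0 : R) : set C := circle (1 - r0%:C) r0.

Definition admissible_radius (F : set C) (r0 : R) : Prop :=
  [/\ 0 < r0,
      horocycle r0 `<=` F `|` [set 1] &
      forall i j, i != j ->
        r0 < 1 / 3 * edist (minor_side i) (minor_side j)].

Definition horo_norm (r0 : R) (g : C -> C) : R :=
  Num.sqrt (1 / radius (g @` horocycle r0)).

Definition orbit_below (r0 T : R) : set C :=
  [set g 1 | g in [set g | Gamma0 g /\ horo_norm r0 g < T]].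

End ReflectionGroup.
End Plane.

(* Main.v *)
(* Reflecting the free arc through 1 in the mirror at one of its ends shows that
   the points of the orbit of 1 next to 1 on the circle are rho_1 1 and rho_3 1;
   translating by g, the points next to g 1 are g rho_1 1 and g rho_3 1.  Let
   g1 1 and g2 1 be neighbors below level T, and let u = g1 rho_j 1 be the orbit
   point following g1 1 on the empty arc.  Either u = g2 1, so g2 = g1 rho_j, or
   u is on the empty arc, so ||g2|| < T <= ||g1 rho_j||; symmetrically from the
   other end of the arc.  It remains to bound ||g rho_j|| <= B ||g|| uniformly
   in g.  Here ||g||^2 = 1 + (1 - r0) / r0 / |g' 1|, and |g'| on the circle is the
   Poisson kernel of the point q = g^-1 0; by ping-pong q is 0 or lies in one of
   the three discs, so it stays away from 1 and |g' 1| / |g' (rho_j 1)| is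
   bounded. *)
Require Import Defs.
From mathcomp Require Import all_boot all_order all_algebra.
From mathcomp Require Import all_classical all_reals all_analysis.
From mathcomp Require Import complex ring lra.
Import Order.TTheory GRing.Theory Num.Theory.
Local Open Scope classical_set_scope.
Local Open Scope complex_scope.
Local Open Scope ring_scope.

Set Implicit Arguments.
Unset Strict Implicit.
Unset Printing Implicit Defensive.

(** * Inversions in circles orthogonal to the unit circle *)

Section Inversions.
Context {R : realType}.
Implicit Types (z w a b : R[i]) (c : R[i]) (r : R).

Lemma normc_ge0 z : 0 <= normc z.
Proof. by case: z => x y; apply: sqrtr_ge0. Qed.

Lemma sqr_normcE z : normc z ^+ 2 = complex.Re z ^+ 2 + complex.Im z ^+ 2.
Proof. by case: z => x y /=; rewrite sqr_sqrtr // addr_ge0 ?sqr_ge0. Qed.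

Lemma normc_eq0 z : (normc z == 0) = (z == 0).
Proof.
apply/eqP/eqP => [/ComplexField.Normc.eq0_normc //|->].
exact: ComplexField.Normc.normc0.
Qed.

Lemma normc_conj z : normc z^* = normc z.
Proof. by case: z => x y /=; rewrite sqrrN. Qed.

Lemma normc_real (x : R) : normc x%:C = `|x|.
Proof. by rewrite /= expr0n addr0 sqrtr_sqr. Qed.

Lemma normc_dist z w : normc (z - w) = normc (w - z).
Proof. by rewrite -(normcN (z - w)) opprB. Qed.

Lemma ler_normc_dist v z w : normc (z - w) <= normc (z - v) + normc (v - w).
Proof. by rewrite -[z - w](subrKA v) le_normcD. Qed.

Lemma conj_realC (x : R) : (x%:C)^* = x%:C :> R[i].
Proof. exact: conjc_real. Qed.

Lemma inversionB {c r z w} : z != c -> w != c ->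
  inversion c r z - inversion c r w
  = (r ^+ 2)%:C * (w - z)^* / ((z - c)^* * (w - c)^*).
Proof.
rewrite -(subr_eq0 z) -(subr_eq0 w) -(conjC_eq0 (z - c)) -(conjC_eq0 (w - c)).
rewrite /inversion !rmorphB /= => zc wc; field; exact/andP.
Qed.

Lemma normc_inversionB {c r z w} : z != c -> w != c ->
  normc (inversion c r z - inversion c r w)
  = r ^+ 2 * normc (z - w) / (normc (z - c) * normc (w - c)).
Proof.
move=> zc wc; rewrite inversionB //.
rewrite !(ComplexField.Normc.normcM, ComplexField.Normc.normcV) !normc_conj.
by rewrite normc_real ger0_norm ?sqr_ge0 // (normc_dist w).
Qed.

Lemma normc_inversion_center c r z :
  normc (inversion c r z - c) = r ^+ 2 / normc (z - c).
Proof.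
rewrite /inversion addrAC subrr add0r.
rewrite ComplexField.Normc.normcM ComplexField.Normc.normcV normc_conj.
by rewrite normc_real ger0_norm ?sqr_ge0.
Qed.

Lemma inversionK c r : 0 < r -> involutive (inversion c r).
Proof.
move=> r0 z; rewrite {1}/inversion {1}/inversion (addrAC c) subrr add0r.
rewrite fmorph_div /= conj_realC conjCK invfM invrK mulrA.
rewrite divff ?mul1r ?subrKC //.
by rewrite (inj_eq (@complexI R) _ 0) sqrf_eq0 gt_eqF.
Qed.

Lemma sqr_normcM z : (normc z ^+ 2)%:C = z * z^*.
Proof.
rewrite sqr_normcE; case: z => x y; apply/eqP.
by rewrite eq_complex /=; apply/andP; split; apply/eqP; ring.
Qed.

(** The hypothesis on [c] expresses orthogonality to the unit circle, and
    [r ^+ 2 / normc (z - c) ^+ 2] is the modulus of the derivative: this is invariance of the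
    hyperbolic metric. *)
Lemma one_sub_sqr_inversion {c r z} : normc c ^+ 2 = 1 + r ^+ 2 -> z != c ->
  1 - normc (inversion c r z) ^+ 2
  = (1 - normc z ^+ 2) * (r ^+ 2 / normc (z - c) ^+ 2).
Proof.
move=> cr; rewrite -subr_eq0 => zc.
have zc' : (z - c)^* != 0 by rewrite conjC_eq0.
(* Eliminating [r] by orthogonality leaves a rational identity in [c], [z] and their conjugates. *)
have r2 : (r ^+ 2)%:C = c * c^* - 1.
  by rewrite -sqr_normcM cr rmorphD addrC addKr.
apply: (@complexI R).
rewrite [RHS]rmorphM fmorph_div !rmorphB rmorph1 /= !sqr_normcM.
rewrite /inversion [(c + _)^*]rmorphD /= fmorph_div /= conj_realC conjCK r2.
by move: zc'; rewrite rmorphB => zc'; field; apply/andP.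
Qed.
End Inversions.

(** * Orientation of triples of points on the unit circle *)

Section Orientation.
Context {R : realType}.
Implicit Types (z w a b d : R[i]) (c : R[i]) (r : R).

(* Twice the signed area of the triangle a b d. *)
Definition orient a b d : R := complex.Im ((b - a)^* * (d - a)).

Lemma orient_rot a b d : orient b d a = orient a b d.
Proof. by rewrite /orient; case: a b d => [a a'] [b b'] [d d'] /=; ring. Qed.

Lemma orient_swap a b d : orient a d b = - orient a b d.
Proof. by rewrite /orient; case: a b d => [a a'] [b b'] [d d'] /=; ring. Qed.

Lemma orient_id a b : orient a a b = 0.
Proof. by rewrite /orient subrr rmorph0 mul0r. Qed.

Lemma normc1_conj {z} : normc z = 1 -> z != 0 /\ z^* = z^-1.
Proof.
move=> z1; have zz : z * z^* = 1 by rewrite -sqr_normcM z1 expr1n.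
have z0 : z != 0 by rewrite -normc_eq0 z1 oner_eq0.
by split=> //; apply: (mulfI z0); rewrite zz divff.
Qed.

(** On the unit circle the conjugate is the inverse, and [2 * 'i] times an imaginary part is a
    number minus its conjugate; the area thus becomes a rational function of the vertices. *)
Lemma orient_unit_circle {a b d} : normc a = 1 -> normc b = 1 -> normc d = 1 ->
  (orient a b d)%:C * (2 * 'i) = (a - b) * (d - a) * (d - b) / (a * b * d).
Proof.
move=> /normc1_conj[a0 aE] /normc1_conj[b0 bE] /normc1_conj[d0 dE].
have ImE z : (complex.Im z)%:C * (2 * 'i) = z - z^*.
  rewrite -(complexiE R); case: z => x y; apply/eqP; rewrite eq_complex /=.
  by apply/andP; split; apply/eqP; ring.
rewrite ImE [X in _ - X]rmorphM /= conjCK !rmorphB /= aE bE dE.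
by field; apply/and3P.
Qed.

Lemma inversion_unit_circle {c r z} : normc c ^+ 2 = 1 + r ^+ 2 -> z != c ->
  normc z = 1 -> normc (inversion c r z) = 1.
Proof.
move=> cr zc z1; have := one_sub_sqr_inversion cr zc.
rewrite z1 expr1n subrr mul0r => /eqP; rewrite subr_eq0 eq_sym => /eqP h.
by apply/eqP; rewrite -(eqrXn2 (n := 2)) ?normc_ge0 // h expr1n.
Qed.

(** The sign reflects that inversions reverse orientation; the three factors are the moduli of the
    derivative at the vertices. *)
Lemma orient_inversion {c r a b d} : normc c ^+ 2 = 1 + r ^+ 2 ->
  a != c -> b != c -> d != c -> normc a = 1 -> normc b = 1 -> normc d = 1 ->
  orient (inversion c r a) (inversion c r b) (inversion c r d)
  = - (r ^+ 2 / normc (a - c) ^+ 2 * (r ^+ 2 / normc (b - c) ^+ 2) *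
       (r ^+ 2 / normc (d - c) ^+ 2) * orient a b d).
Proof.
move=> cr ac bc dc a1 b1 d1.
have i0 : (2 * 'i : R[i]) != 0 by rewrite mulf_neq0 ?pnatr_eq0 ?neq0Ci.
apply: (@complexI R); apply: (mulIf i0).
rewrite rmorphN mulNr [X in - (X * _)]rmorphM -[X in - X]mulrA /=.
rewrite !orient_unit_circle ?inversion_unit_circle //.
have r2 : (r ^+ 2)%:C = c * c^* - 1.
  by rewrite -sqr_normcM cr rmorphD addrC addKr.
(* On the unit circle the inversion agrees with a Möbius map and its derivative factor is rational
   in [z], so that [field] applies. *)
have key z : normc z = 1 -> z != c ->
  [/\ z != 0, c - z != 0, 1 - c^* * z != 0, inversion c r z = (c - z) / (1 - c^* * z)
   & (r ^+ 2 / normc (z - c) ^+ 2)%:C = - (c * c^* - 1) * z / ((c - z) * (1 - c^* * z))].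
  move=> z1 zc; have [z0 zE] := normc1_conj z1.
  have h1 : c - z != 0 by rewrite subr_eq0 eq_sym.
  have : (z - c)^* != 0 by rewrite conjC_eq0 -opprB oppr_eq0.
  rewrite rmorphB /= zE => h2.
  have h3 : 1 - c^* * z != 0 by have := mulf_neq0 h2 z0; rewrite mulrBl mulVf.
  split => //.
    by rewrite /inversion rmorphB /= zE r2; field; apply/andP.
  rewrite [LHS]rmorphM fmorphV /= sqr_normcM r2 rmorphB /= zE; field.
  by apply/and4P; split=> //; rewrite subr_eq0.
have [a0 ca h1a -> Ja] := key a a1 ac.
have [b0 cb h1b -> Jb] := key b b1 bc.
have [d0 cd h1d -> Jd] := key d d1 dc.
rewrite 2!rmorphM /= Ja Jb Jd; field.
by rewrite d0 b0 a0 /=; apply/and4P; split=> //; apply/and3P; split.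
Qed.

End Orientation.

(** * Automorphisms of the disk and their action on horocycles *)

Section DiskMaps.
Context {R : realType}.
Implicit Types (z w a b d xi : R[i]) (c : R[i]) (r k : R) (g h : R[i] -> R[i]).

(* J plays the role of |g'|; the identities are those of a holomorphic or
   antiholomorphic automorphism of the disk. *)
Record disk_map (J : R[i] -> R) g : Prop := DiskMap {
  disk_map_gt0 : forall z, normc z <= 1 -> 0 < J z;
  disk_map_sub1 : forall z, normc z <= 1 ->
    1 - normc (g z) ^+ 2 = (1 - normc z ^+ 2) * J z;
  disk_map_dist : forall z w, normc z <= 1 -> normc w <= 1 ->
    normc (g z - g w) ^+ 2 = normc (z - w) ^+ 2 * (J z * J w);
  disk_map_orient : exists e : bool, forall a b d,
    normc a = 1 -> normc b = 1 -> normc d = 1 ->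
    orient (g a) (g b) (g d) = (-1) ^+ e * (J a * J b * J d) * orient a b d
}.

Lemma disk_map_le1 J g z : disk_map J g -> normc z <= 1 -> normc (g z) <= 1.
Proof.
move=> hg z1; rewrite -(expr_le1 (n := 2)) ?normc_ge0 // -subr_ge0.
rewrite (disk_map_sub1 hg) //; apply: mulr_ge0.
  by rewrite subr_ge0 expr_le1 ?normc_ge0.
exact: ltW (disk_map_gt0 hg z1).
Qed.

Lemma disk_map_eq1 J g z : disk_map J g -> normc z = 1 -> normc (g z) = 1.
Proof.
move=> hg z1; have := disk_map_sub1 hg (z := z).
rewrite z1 expr1n subrr mul0r => /(_ (lexx _))/eqP; rewrite subr_eq0 => /eqP h.
by apply/eqP; rewrite -(eqrXn2 (n := 2)) ?normc_ge0 // -h expr1n.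
Qed.

Lemma disk_map_id : disk_map (fun=> 1) id.
Proof.
split=> [//|z _|z w _ _|]; rewrite ?mulr1 //.
by exists false => a b d _ _ _; rewrite !mul1r.
Qed.

(** The factor follows the chain rule, and the orientation signs multiply, hence the exclusive
    or. *)
Lemma disk_map_comp J K g h : disk_map J g -> disk_map K h ->
  disk_map (fun z => J (h z) * K z) (g \o h).
Proof.
move=> hg hh; split=> [z z1|z z1|z w z1 w1|] /=.
- by rewrite mulr_gt0 ?(disk_map_gt0 hg) ?(disk_map_gt0 hh) ?(disk_map_le1 hh).
- rewrite (disk_map_sub1 hg) ?(disk_map_le1 hh) // (disk_map_sub1 hh) //.
  by rewrite -mulrA (mulrC (K z)).
- rewrite (disk_map_dist hg) ?(disk_map_le1 hh) // (disk_map_dist hh) //; ring.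
- have [e he] := disk_map_orient hg; have [f hf] := disk_map_orient hh.
  exists (e (+) f) => a b d a1 b1 d1.
  rewrite he ?(disk_map_eq1 hh) // hf // signr_addb; ring.
Qed.

Lemma disk_map_inversion c r : 0 < r -> normc c ^+ 2 = 1 + r ^+ 2 ->
  disk_map (fun z => r ^+ 2 / normc (z - c) ^+ 2) (inversion c r).
Proof.
move=> r0 cr.
(* The center has modulus greater than 1, so no point of the closed disk is exceptional. *)
have zc z : normc z <= 1 -> z != c.
  apply: contraTneq => ->; rewrite -ltNge -(expr_gt1 (n := 2)) ?normc_ge0 // cr.
  by rewrite ltrDl exprn_gt0.
have nzc z : normc z <= 1 -> normc (z - c) != 0.
  by move=> /zc; rewrite normc_eq0 subr_eq0.
split=> [z z1|z z1|z w z1 w1|].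
- by rewrite divr_gt0 ?exprn_gt0 // lt0r nzc ?normc_ge0.
- exact: one_sub_sqr_inversion (zc _ _).
- rewrite (normc_inversionB (zc _ z1) (zc _ w1)); field.
  by apply/andP; split; apply: nzc.
- exists true => a b d a1 b1 d1.
  rewrite (orient_inversion cr) ?zc ?a1 ?b1 ?d1 ?lexx // expr1; ring.
Qed.

(* The horocycle at xi on which the Poisson kernel is equal to k. *)
Definition horo xi k : set R[i] :=
  [set z | 1 - normc z ^+ 2 = k * normc (z - xi) ^+ 2].

(** Completing the square: since [normc xi = 1], the two equations differ only by the factor
    [1 + k]. *)
Lemma horo_circle xi k : normc xi = 1 -> 0 < k ->
  horo xi k = circle (xi * (k / (1 + k))%:C) (1 / (1 + k)).
Proof.
move=> xi1 k0; have k1 : 0 < 1 + k by rewrite addr_gt0.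
have key z : (1 + k) * (normc (z - xi * (k / (1 + k))%:C) ^+ 2 - (1 / (1 + k)) ^+ 2) =
    k * normc (z - xi) ^+ 2 - (1 - normc z ^+ 2).
  have : normc xi ^+ 2 = 1 by rewrite xi1 expr1n.
  rewrite !sqr_normcE; case: xi {xi1} z => [x y] [u v] /= xi1.
  apply/eqP; rewrite -subr_eq0; apply/eqP.
  transitivity ((1 - (x ^+ 2 + y ^+ 2)) * (k / (1 + k))).
    by field; rewrite gt_eqF.
  by rewrite xi1 subrr mul0r.
apply/seteqP; split=> z /=; rewrite /horo /circle /=.
  move=> hz; have := key z; rewrite -hz subrr => /eqP.
  rewrite mulf_eq0 gt_eqF //= subr_eq0 eqrXn2 ?normc_ge0 ?divr_ge0 ?ltW //.
  by move/eqP.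
by move=> hz; have := key z; rewrite hz subrr mulr0 => /esym/eqP; rewrite subr_eq0 => /eqP.
Qed.

(** Both sides of the equation of a horocycle pick up the factor [J z] under [g], and the squared
    distance to [xi] also picks up [J xi], which the new level compensates. The inverse [h] supplies
    preimages in the closed disk. *)
Lemma image_horo J K g h xi k : disk_map J g -> disk_map K h ->
  cancel h g -> normc xi = 1 -> 0 <= k ->
  g @` horo xi k = horo (g xi) (k / J xi).
Proof.
move=> hg hh gK xi1 k0.
have le1 z w l : 0 <= l -> 1 - normc z ^+ 2 = l * normc (z - w) ^+ 2 -> normc z <= 1.
  move=> l0 e; rewrite -(expr_le1 (n := 2)) ?normc_ge0 // -subr_ge0 e.
  by rewrite mulr_ge0 ?sqr_ge0.
have Jxi : 0 < J xi by rewrite (disk_map_gt0 hg) // xi1.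
have eqv z : normc z <= 1 -> horo xi k z <-> horo (g xi) (k / J xi) (g z).
  move=> z1; rewrite /horo /= (disk_map_sub1 hg) // (disk_map_dist hg) ?xi1 //.
  have -> : k / J xi * (normc (z - xi) ^+ 2 * (J z * J xi))
          = k * normc (z - xi) ^+ 2 * J z by field; rewrite gt_eqF.
  have Jz : J z != 0 by rewrite gt_eqF // (disk_map_gt0 hg).
  by split=> [->//|/(mulIf Jz)].
apply/seteqP; split=> [_ [z hz <-]|z hz]; first by apply/eqv => //; exact: le1 hz.
have z1 : normc z <= 1 by apply: le1 hz; rewrite divr_ge0 // ltW.
exists (h z) => //; apply/eqv; first exact: disk_map_le1 hh z1.
by rewrite gK.
Qed.

End DiskMaps.

(** * The norm as a function of the derivative at 1, and its growth *)

Section HoroNorm.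
Context {R : realType}.
Implicit Types (z w q xi : R[i]) (c : R[i]) (r k : R) (g h s : R[i] -> R[i]).

(** The opposite points [c + r] and [c - r] are [2 r] apart, while points of the larger set are at
    most [2 r'] apart. *)
Lemma circle_radius_le c c' r r' : 0 <= r -> 0 <= r' ->
  circle c r `<=` circle c' r' -> r <= r'.
Proof.
move=> r0 r'0 sub.
have e1 : normc (c + r%:C - c') = r'.
  by apply: sub; rewrite /circle /= addrAC subrr add0r normc_real ger0_norm.
have e2 : normc (c - r%:C - c') = r'.
  by apply: sub; rewrite /circle /= addrAC subrr add0r normcN normc_real ger0_norm.
have := le_normcD (c + r%:C - c') (- (c - r%:C - c')).
rewrite normcN e1 e2.
have -> : c + r%:C - c' + - (c - r%:C - c') = (r + r)%:C.
  by rewrite rmorphD /=; ring.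
by rewrite normc_real ger0_norm ?addr_ge0 // -!mulr2n lerMn2r.
Qed.

(** [xget] may choose any radius that describes the set, so uniqueness of the radius is what is
    needed. *)
Lemma radius_circle c r : 0 < r -> Defs.radius (circle c r) = r.
Proof.
move=> r0; rewrite /Defs.radius; set S := [set _ | _].
have Sr : S r by split=> //; exists c.
have [x0 [c' e]] := xgetPex 0 (ex_intro _ r Sr).
by apply/eqP; rewrite eq_le; apply/andP; split;
  [apply: (@circle_radius_le c' c) | apply: (@circle_radius_le c c')];
  rewrite ?ltW // -e.
Qed.

(** [horocycle r0] is the horocycle at 1 of level [(1 - r0) / r0]; [g] divides the level by [J 1],
    and level [k] means radius [1 / (1 + k)]. *)
Lemma horo_normE r0 J K g h : 0 < r0 < 1 -> disk_map J g -> disk_map K h ->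
  cancel h g -> horo_norm r0 g = Num.sqrt (1 + (1 - r0) / r0 / J 1).
Proof.
move=> /andP[r0_gt0 r0_lt1] hg hh gK.
have n1 : normc (1 : R[i]) = 1 by exact: ComplexField.Normc.normc1.
have J1 : 0 < J 1 by rewrite (disk_map_gt0 hg) // n1.
have k0 : 0 < (1 - r0) / r0 by rewrite divr_gt0 // subr_gt0.
have horoE : horocycle r0 = horo 1 ((1 - r0) / r0).
  have r0N : r0 != 0 by rewrite gt_eqF.
  have -> : horo (1 : R[i]) ((1 - r0) / r0) = circle (1 - r0)%:C r0.
    rewrite horo_circle // mul1r.
    have -> : 1 + (1 - r0) / r0 = r0^-1 by field.
    by rewrite invrK mul1r divfK.
  by rewrite rmorphB.
have g1 := disk_map_eq1 hg n1.
rewrite /horo_norm horoE (image_horo hg hh gK n1 (ltW k0)).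
have kJ0 : 0 < (1 - r0) / r0 / J 1 by exact: divr_gt0.
rewrite horo_circle // radius_circle; last by rewrite divr_gt0 ?addr_gt0.
by rewrite !div1r invrK.
Qed.

(** Taking [z = q] in the two metric identities of [g] gives two expressions equal to 1 with the
    common factor [J q], which cancels. *)
Lemma disk_map_poisson J g q xi : disk_map J g -> normc q <= 1 -> g q = 0 ->
  normc xi = 1 -> J xi * normc (q - xi) ^+ 2 = 1 - normc q ^+ 2.
Proof.
move=> hg q1 gq0 xi1.
have Jq := disk_map_gt0 hg q1.
have := disk_map_sub1 hg q1; have := disk_map_dist hg q1 (w := xi).
rewrite xi1 lexx gq0 sub0r normcN (disk_map_eq1 hg xi1) ComplexField.Normc.normc0 expr1n.
rewrite expr0n subr0 => /(_ isT) e1 e2.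
by apply: (mulIf (lt0r_neq0 Jq)); rewrite -e2 [RHS]e1; ring.
Qed.

(** With [q = h 0], the ratio of [J 1] to [J (s 1)] is a quotient of Poisson kernels in which
    [1 - normc q ^+ 2] cancels. What remains is at most [4 * E]: 4 bounds squared distances in the
    closed disk, and [E] keeps [q] away from 1. *)
Lemma horo_norm_comp_le r0 (E : R) J K L M g h s s' : 0 < r0 < 1 ->
  disk_map J g -> disk_map K h -> cancel h g ->
  disk_map L s -> disk_map M s' -> cancel s' s ->
  0 <= E -> 1 <= E * normc (h 0 - 1) ^+ 2 ->
  horo_norm r0 (g \o s) <= Num.sqrt (1 + 4 * E / L 1) * horo_norm r0 g.
Proof.
move=> r01 hg hh gK hs hs' sK E0 hE.
have [r0_gt0 r0_lt1] := andP r01.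
have n1 : normc (1 : R[i]) = 1 by exact: ComplexField.Normc.normc1.
have s1 : normc (s 1) = 1 := disk_map_eq1 hs n1.
have q1 : normc (h 0) <= 1.
  by rewrite (disk_map_le1 hh) // ComplexField.Normc.normc0.
have p1 := disk_map_poisson hg q1 (gK 0) n1.
have ps := disk_map_poisson hg q1 (gK 0) s1.
have J1 : 0 < J 1 by rewrite (disk_map_gt0 hg) // n1.
have Js : 0 < J (s 1) by rewrite (disk_map_gt0 hg) // s1.
have L1 : 0 < L 1 by rewrite (disk_map_gt0 hs) // n1.
have [J1' Js' L1'] := And3 (ltW J1) (ltW Js) (ltW L1).
have gsK : cancel (s' \o h) (g \o s) by move=> z /=; rewrite sK gK.
rewrite (horo_normE r01 (disk_map_comp hg hs) (disk_map_comp hs' hh) gsK).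
rewrite (horo_normE r01 hg hh gK).
set k := (1 - r0) / r0; have k0 : 0 <= k by apply: divr_ge0; rewrite ?subr_ge0; apply: ltW.
have EL : 0 <= 4 * E / L 1 by rewrite divr_ge0 ?mulr_ge0.
rewrite -sqrtrM ?addr_ge0 // ler_sqrt; last first.
  by apply: mulr_ge0; apply: addr_ge0 => //; apply: divr_ge0.
have le4 : normc (h 0 - s 1) ^+ 2 <= 4.
  have -> : 4 = 2 ^+ 2 :> R by ring.
  rewrite lerXn2r ?nnegrE ?normc_ge0 //.
  apply: le_trans (le_normcD _ _) _; rewrite normcN s1 -[2]/(1 + 1).
  by rewrite lerD.
have JJ : (J (s 1))^-1 <= 4 * E / J 1.
  rewrite -div1r ler_pdivrMr // mulrAC ler_pdivlMr // mul1r.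
  have : J 1 <= E * (J 1 * normc (h 0 - 1) ^+ 2).
    by rewrite mulrCA -[X in X <= _]mulr1 ler_wpM2l.
  move/le_trans; apply; rewrite p1 -ps (mulrC 4) -mulrA ler_wpM2l //.
  by rewrite mulrC ler_wpM2r.
rewrite mulrDl mul1r -addrA lerD2l mulrDr mulr1.
have -> : k / (J (s 1) * L 1) = k / L 1 * (J (s 1))^-1.
  by field; rewrite !gt_eqF.
apply: (@le_trans _ _ (k / L 1 * (4 * E / J 1))).
  by rewrite ler_wpM2l // divr_ge0.
have -> : 4 * E / L 1 * (k / J 1) = k / L 1 * (4 * E / J 1).
  by field; rewrite !gt_eqF.
by rewrite addrA lerDr addr_ge0 // divr_ge0.
Qed.

End HoroNorm.

(** * Angles, orientation and arcs of the unit circle *)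

Section Angles.
Context {R : realType}.
Implicit Types (z w a b d xi : R[i]) (s t u : R).

Lemma normc_cis t : normc (cis t) = 1.
Proof. by rewrite /= cos2Dsin2 sqrtr1. Qed.

Lemma cis_surj z : normc z = 1 -> exists2 t, 0 <= t < 2 * pi & z = cis t.
Proof.
move=> z1; have := sqr_normcE z; rewrite z1 expr1n; case: z z1 => x y _ /= /esym e.
have x1 : -1 <= x <= 1.
  by rewrite -ler_norml -(expr_le1 (n := 2)) // real_normK ?num_real // -e lerDl sqr_ge0.
have sE : sin (acos x) = `|y|.
  by rewrite sin_acos // -e addrAC subrr add0r sqrtr_sqr.
have [y0|y0] := leP 0 y.
  exists (acos x); last by rewrite /cis acosK ?in_itv //= sE ger0_norm.
  by rewrite acos_ge0 //= (le_lt_trans (acos_lepi x1)) // mulr_natl mulr2n ltrDl pi_gt0.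
(* Below the real axis the angle is [2 * pi - acos x], which is less than [2 * pi] only because [x]
   is not 1. *)
have xN1 : x < 1.
  rewrite lt_neqAle (andP x1).2 andbT; apply: contraTneq y0 => xE.
  move: e; rewrite xE expr1n -[RHS]addr0 => /addrI/eqP; rewrite sqrf_eq0 => /eqP->.
  by rewrite ltxx.
have a0 : 0 < acos x by rewrite acos_gt0 // (andP x1).1.
exists (2 * pi - acos x).
  rewrite subr_ge0 ltrBlDr ltrDl a0 andbT (le_trans (acos_lepi x1)) //.
  by rewrite mulr_natl mulr2n lerDl pi_ge0.
rewrite /cis mulr_natl.
have -> : cos (pi *+ 2 - acos x) = x.
  by rewrite cosB cos2pi sin2pi mul0r addr0 mul1r acosK // in_itv.
have -> : sin (pi *+ 2 - acos x) = y.
  by rewrite sinB cos2pi sin2pi mul0r mul1r sub0r sE ltr0_norm // opprK.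
by [].
Qed.

Lemma circle_surj a b : normc a = 1 -> normc b = 1 ->
  exists2 t, 0 <= t < 2 * pi & b = a * cis t.
Proof.
move=> a1 b1; have a0 : a != 0 by rewrite -normc_eq0 a1 oner_eq0.
have [|t tb e] := @cis_surj (a^-1 * b).
  by rewrite ComplexField.Normc.normcM ComplexField.Normc.normcV a1 b1 invr1 mulr1.
by exists t => //; rewrite -e mulVKf.
Qed.

Lemma orient_cis a s t : normc a = 1 ->
  orient a (a * cis t) (a * cis s)
  = 4 * (sin (t / 2) * sin (s / 2)) * sin ((s - t) / 2).
Proof.
move=> a1.
have -> : orient a (a * cis t) (a * cis s) = orient 1 (cis t) (cis s).
  have aa : a^* * a = 1 by rewrite mulrC -sqr_normcM a1 expr1n.
  rewrite /orient -{2 4}[a]mulr1 -!mulrBr rmorphM /=.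
  by rewrite mulrACA aa mul1r.
have e u : cis u = (1 - 2 * sin (u / 2) ^+ 2) +i* (2 * sin (u / 2) * cos (u / 2)).
  rewrite /cis; have {1 2}-> : u = u / 2 *+ 2 by rewrite -mulr_natr divfK ?pnatr_eq0.
  rewrite cos_mulr2n sin_mulr2n cos2sin2; congr (_ +i* _); ring.
rewrite !e /orient mulrBl sinB /=; set x := sin _; set y := sin _.
ring.
Qed.

(** Half angles of nonzero angles lie strictly between 0 and [pi] and have positive sine, so the
    sign in [orient_cis] is that of [s - t]. *)
Lemma orient_cis_gt0 a s t : normc a = 1 -> 0 <= t < 2 * pi -> 0 <= s < 2 * pi ->
  (0 < orient a (a * cis t) (a * cis s)) = (0 < t < s).
Proof.
move=> a1 /andP[t0 t2] /andP[s0 s2]; rewrite orient_cis //.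
have half u : 0 < u -> u < 2 * pi -> 0 < sin (u / 2).
  by move=> u0 u2; rewrite sin_gt0_pi // divr_gt0 //= ltr_pdivrMr // mulrC.
have [->|tN0] := eqVneq t 0.
  by rewrite mul0r sin0 mul0r mulr0 mul0r ltxx.
have {t0 tN0}t0 : 0 < t by rewrite lt0r tN0.
have [->|sN0] := eqVneq s 0.
  by rewrite mul0r sin0 mulr0 mulr0 mul0r ltxx t0 /= ltNge (ltW t0).
have {s0 sN0}s0 : 0 < s by rewrite lt0r sN0.
rewrite t0 pmulr_rgt0 ?mulr_gt0 ?(half t) ?(half s) //=.
have [ts|st] := ltP t s.
  by rewrite half ?subr_gt0 // ltrBlDr (lt_trans s2) // ltrDl.
apply/negbTE; rewrite -leNgt -oppr_ge0 -sinN -mulNr opprB.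
have [->|ts] := eqVneq t s; first by rewrite subrr mul0r sin0.
have {}ts : s < t by rewrite lt_neqAle st eq_sym ts.
rewrite ltW // half ?subr_gt0 //.
by rewrite ltrBlDr (lt_trans t2) // ltrDl.
Qed.

(** Angles measured from [a] turn the cyclic order into the linear order of an interval, which is
    transitive. *)
Lemma orient_gt0_trans a b d w : normc a = 1 -> normc b = 1 -> normc d = 1 ->
  normc w = 1 -> 0 < orient a b d -> 0 < orient a d w -> 0 < orient a b w.
Proof.
move=> a1 /(circle_surj a1)[s sb ->] /(circle_surj a1)[t tb ->].
move=> /(circle_surj a1)[u ub ->]; rewrite !orient_cis_gt0 //.
by move=> /andP[-> st] /andP[_ tu]; exact: lt_trans st tu.
Qed.

Lemma orient_neq0 a b d : normc a = 1 -> normc b = 1 -> normc d = 1 ->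
  a != b -> b != d -> d != a -> orient a b d != 0.
Proof.
move=> a1 b1 d1 ab bd da.
have := orient_unit_circle a1 b1 d1; apply: contra_eq_neq => ->.
have [a0 b0 d0] := And3 (normc1_conj a1).1 (normc1_conj b1).1 (normc1_conj d1).1.
by rewrite mul0r eq_sym !mulf_neq0 ?invr_eq0 ?mulf_neq0 ?subr_eq0 // eq_sym.
Qed.

(** Distinct ends exclude the full turn, where the arc is nonempty but [orient] vanishes. *)
Lemma ccw_arcP a b z : normc a = 1 -> normc b = 1 -> a != b ->
  ccw_arc a b z <-> normc z = 1 /\ 0 < orient a z b.
Proof.
move=> a1 b1 ab.
have [s /andP[s0 s2] bE] := circle_surj a1 b1.
have sN0 : s != 0.
  by apply: contraNneq ab => sE; rewrite bE sE /cis cos0 sin0 mulr1.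
split=> [[s' [t [/andP[s'0 s'2] bE' /andP[t0 ts] ->]]]|[z1]].
  split; first by rewrite ComplexField.Normc.normcM a1 normc_cis mulr1.
  have s'2' : s' < 2 * pi.
    rewrite lt_neqAle s'2 andbT; apply: contraNneq ab => sE.
    by rewrite bE' sE mulr_natl /cis cos2pi sin2pi mulr1.
  rewrite bE' orient_cis_gt0 ?t0 //; last by rewrite ltW.
  by rewrite ltW // (lt_trans ts).
have [t tb ->] := circle_surj a1 z1.
rewrite bE orient_cis_gt0 ?s0 // => tbs.
exists s, t; split=> //; rewrite (ltW s2) andbT.
by case/andP: tbs; exact: lt_trans.
Qed.

End Angles.

(** * Closures and the derivative of an inversion *)

Section PlaneTopology.
Import numFieldNormedType.Exports.
Context {R : realType}.
Implicit Types (z w a b d : R[i]) (c : R[i]) (r : R).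

Lemma nbhs_normc z (e : R) : 0 < e ->
  nbhs (z : R[i]^o) [set w : R[i] | normc (w - z) < e].
Proof.
move=> e0; have : nbhs (z : R[i]^o) (ball (z : R[i]^o) e%:C).
  by apply: nbhsx_ballx; rewrite ltcR.
apply: filterS => w; rewrite -ball_normE /= -opprB normrN => h.
by move: h; rewrite normc_def ltcR; case: (w - z).
Qed.

Lemma closure_normc (F : set R[i]) z (e : R) : closure (F : set R[i]^o) z -> 0 < e ->
  exists2 w, F w & normc (w - z) < e.
Proof.
by move=> cFz e0; have [w [Fw wz]] := cFz _ (nbhs_normc z e0); exists w.
Qed.

Lemma closure_outside (F : set R[i]) c r :
  (forall z, F z -> r <= normc (z - c)) ->
  forall z, closure (F : set R[i]^o) z -> r <= normc (z - c).
Proof.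
move=> hF z cFz; rewrite leNgt; apply/negP => zr.
have [|w Fw wz] := closure_normc cFz (e := r - normc (z - c)).
  by rewrite subr_gt0.
have := hF w Fw; apply/negP; rewrite -ltNge.
by apply: le_lt_trans (ler_normc_dist z w c) _; rewrite -ltrBrDr.
Qed.

(** The difference quotient is exactly [r ^+ 2 / (normc (w - c) * normc (z - c))], so only
    continuity in [w] is at stake. *)
Lemma abs_deriv_inversion c r z : z != c ->
  abs_deriv (inversion c r) z = r ^+ 2 / normc (z - c) ^+ 2.
Proof.
move=> zc; have d0 : 0 < normc (z - c).
  by rewrite lt0r normc_ge0 normc_eq0 subr_eq0 zc.
rewrite /abs_deriv; apply: cvg_lim; first exact: norm_hausdorff.
apply/cvgrPdist_lt => e e0.
set d := normc (z - c) in d0 *.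
(* The first bound keeps [w] farther than [d / 2] from [c]; the second then makes the error less
   than [e], with [+ 1] covering [r = 0]. *)
pose m := Num.min (d / 2) (e * d ^+ 3 / (2 * (r ^+ 2 + 1))).
have r1 : 0 < r ^+ 2 + 1 by rewrite ltr_wpDl ?sqr_ge0.
have m0 : 0 < m.
  by rewrite lt_min !divr_gt0 ?mulr_gt0 ?exprn_gt0.
have : nbhs (z : R[i]^o) [set w : R[i] | normc (w - z) < m] by exact: nbhs_normc.
apply: filterS => w; rewrite /= lt_min => /andP[wd we] wz.
have dw : d / 2 < normc (w - c).
  have := ler_normc_dist w z c; rewrite -/d (normc_dist z w) => h.
  by lra.
have wc : w != c.
  by apply: contraTneq dw => ->; rewrite subrr ComplexField.Normc.normc0 -leNgt divr_ge0 ?normc_ge0.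
rewrite (normc_inversionB wc zc) -/d.
have wz0 : normc (w - z) != 0 by rewrite normc_eq0 subr_eq0.
set D := normc (w - c) in dw *; set x := normc (w - z) in wd we wz0 *.
have D0 : 0 < D by apply: le_lt_trans dw; rewrite divr_ge0 ?ltW.
have -> : r ^+ 2 / d ^+ 2 - r ^+ 2 * x / (D * d) / x = r ^+ 2 * (D - d) / (d ^+ 2 * D).
  by field; rewrite wz0 !gt_eqF.
have Dd : `|D - d| <= x.
  have := ler_normc_dist w z c; rewrite -/d (normc_dist z w) -/D -/x => h1.
  have := ler_normc_dist z w c; rewrite -/d -/D -/x => h2.
  by rewrite ler_norml; lra.
have dD0 : 0 < d ^+ 2 * D by rewrite mulr_gt0 ?exprn_gt0.
rewrite normrM normfV (gtr0_norm dD0) ltr_pdivrMr // normrM ger0_norm ?sqr_ge0 //.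
apply: (@le_lt_trans _ _ (r ^+ 2 * x)); first by rewrite ler_wpM2l ?sqr_ge0.
move: we; rewrite ltr_pdivlMr ?mulr_gt0 // => we.
have x0 : 0 <= x by exact: normc_ge0.
have h1 : 0 < e * d ^+ 2 * (D - d / 2).
  by rewrite !mulr_gt0 ?exprn_gt0 ?subr_gt0.
have -> : e * (d ^+ 2 * D) = e * d ^+ 2 * (D - d / 2) + e * d ^+ 3 / 2 by field.
nra.
Qed.
End PlaneTopology.

(** * Relative position of circles *)

Section Circles.
Context {R : realType}.
Implicit Types (z w a b d : R[i]) (c : R[i]) (r : R).

(** Pythagoras in the triangle formed by 0, [c] and a common point of the circles. *)
Lemma orthogonal_unit_circle c r :
  orthogonal_circles 0 1 c r -> normc c ^+ 2 = 1 + r ^+ 2.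
Proof.
case=> -[z [z1 zr]] /(_ z z1 zr); move: z1 zr; rewrite /circle /= subr0 => z1 zr.
have := sqr_normcE (z - c); have := sqr_normcE z.
rewrite z1 zr expr1n sqr_normcE; case: z c {z1 zr} => [x y] [u v] /= e1 e2 e3.
by rewrite e2; nra.
Qed.

Lemma edist_le0 (A B : set R[i]) z : A z -> B z -> Defs.edist A B <= 0.
Proof.
move=> Az Bz; apply: ge_inf; first by exists 0 => _ [x _] [y _] <-; exact: normc_ge0.
by exists z => //; exists z => //; rewrite subrr ComplexField.Normc.normc0.
Qed.

Lemma circles_meet c1 r1 c2 r2 : c1 != c2 -> 0 < r1 -> 0 < r2 ->
  `|r1 - r2| <= normc (c1 - c2) -> normc (c1 - c2) <= r1 + r2 ->
  circle c1 r1 `&` circle c2 r2 !=set0.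
Proof.
rewrite -subr_eq0 -normc_eq0 => d0 r10 r20; set d := normc (c1 - c2) in d0 *.
have {}d0 : 0 < d by rewrite lt0r d0 normc_ge0.
rewrite ler_norml => /andP[h1 h2] h3.
(* [x], and [y] below, are the coordinates of a common point in the frame where [c1] is 0 and [c2]
   is 1. *)
pose x := (d ^+ 2 + r1 ^+ 2 - r2 ^+ 2) / (2 * d ^+ 2).
have xr : x ^+ 2 <= r1 ^+ 2 / d ^+ 2.
  rewrite /x expr_div_n ler_pdivrMr ?exprn_gt0 ?mulr_gt0 ?exprn_gt0 //.
  have -> : r1 ^+ 2 / d ^+ 2 * (2 * d ^+ 2) ^+ 2 = (2 * d * r1) ^+ 2.
    by field; rewrite gt_eqF.
  (* Heron's factorization: the triangle inequalities make all four factors nonnegative. *)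
  rewrite -subr_ge0 subr_sqr.
  have -> : 2 * d * r1 - (d ^+ 2 + r1 ^+ 2 - r2 ^+ 2)
          = (r1 + r2 - d) * (r2 + d - r1) by ring.
  have -> : 2 * d * r1 + (d ^+ 2 + r1 ^+ 2 - r2 ^+ 2)
          = (d + r1 - r2) * (d + r1 + r2) by ring.
  by rewrite !mulr_ge0 //; lra.
pose y := Num.sqrt (r1 ^+ 2 / d ^+ 2 - x ^+ 2).
have y2 : y ^+ 2 = r1 ^+ 2 / d ^+ 2 - x ^+ 2 by rewrite sqr_sqrtr // subr_ge0.
have dE : normc (c2 - c1) = d by rewrite normc_dist.
exists (c1 + (c2 - c1) * (x +i* y)); split; rewrite /circle /=; apply/eqP.
  rewrite addrAC subrr add0r -(eqrXn2 (n := 2)) ?normc_ge0 ?(ltW r10) //.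
  rewrite ComplexField.Normc.normcM exprMn dE (sqr_normcE (x +i* y)) /= y2.
  by apply/eqP; field; rewrite gt_eqF.
have -> : c1 + (c2 - c1) * (x +i* y) - c2 = (c2 - c1) * ((x - 1) +i* y).
  have -> : (x - 1) +i* y = (x +i* y) - 1 :> R[i].
    by apply/eqP; rewrite eq_complex /= subr0 !eqxx.
  by ring.
rewrite -(eqrXn2 (n := 2)) ?normc_ge0 ?(ltW r20) //.
rewrite ComplexField.Normc.normcM exprMn dE (sqr_normcE ((x - 1) +i* y)) /= y2.
by apply/eqP; rewrite /x; field; rewrite gt_eqF.
Qed.

Lemma inversion0_in_disk c r : 0 < r -> normc c ^+ 2 = 1 + r ^+ 2 ->
  normc (inversion c r 0) < 1 /\ normc (inversion c r 0 - c) < r.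
Proof.
move=> r0 cr.
have rc : r < normc c.
  rewrite -(ltr_pXn2r (n := 2)) ?nnegrE ?normc_ge0 ?(ltW r0) //.
  by rewrite cr ltr_pwDl.
have c0 : c != 0 by rewrite -normc_eq0 gt_eqF // (lt_trans r0).
split; last first.
  rewrite normc_inversion_center sub0r normcN ltr_pdivrMr ?(lt_trans r0) //.
  by rewrite expr2 ltr_pM2l.
rewrite -(expr_lt1 (n := 2)) ?normc_ge0 // -subr_gt0 (one_sub_sqr_inversion cr); last by rewrite eq_sym.
rewrite ComplexField.Normc.normc0 expr0n subr0 mul1r sub0r normcN.
by rewrite divr_gt0 ?exprn_gt0 // (lt_trans r0).
Qed.

(** Otherwise the discs are nested, and the inner one contains the image of 0, a common point inside
    the unit disk; or the circles coincide; or they cross. *)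
Lemma discs_apart c1 r1 c2 r2 : 0 < r1 -> 0 < r2 ->
  normc c1 ^+ 2 = 1 + r1 ^+ 2 -> normc c2 ^+ 2 = 1 + r2 ^+ 2 ->
  circle c1 r1 `&` circle c2 r2 = set0 ->
  (forall z, normc z < 1 -> normc (z - c1) < r1 -> ~ normc (z - c2) < r2) ->
  r1 + r2 < normc (c1 - c2).
Proof.
move=> r10 r20 cr1 cr2 meet disj; rewrite ltNge; apply/negP => d12.
have [z1D z1r] := inversion0_in_disk r10 cr1.
have [z2D z2r] := inversion0_in_disk r20 cr2.
have [lt12|le12] := ltP (normc (c1 - c2)) (r2 - r1).
  apply: (disj _ z1D z1r); apply: le_lt_trans (ler_normc_dist c1 _ c2) _.
  by lra.
have [lt21|le21] := ltP (normc (c1 - c2)) (r1 - r2).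
  apply: (disj _ z2D) => //; apply: le_lt_trans (ler_normc_dist c2 _ c1) _.
  by rewrite (normc_dist c2); lra.
have [e|c12] := eqVneq c1 c2.
  have r12 : r1 = r2.
    move: le12 le21; rewrite e subrr ComplexField.Normc.normc0 !subr_le0 => h1 h2.
    by apply/eqP; rewrite eq_le h1 h2.
  have : set0 (c1 + r1%:C).
    rewrite -meet e -r12 setIid /circle /= addrAC subrr add0r normc_real.
    by rewrite ger0_norm // ltW.
  by [].
have [] := circles_meet c12 r10 r20 _ d12.
  by rewrite ler_norml; lra.
by move=> z; rewrite meet.
Qed.

End Circles.

(** * Words in the reflections, ping-pong and gaps in the orbit of 1 *)

Section Reflections.
Context {R : realType}.
Variables (c : 'I_3 -> R[i]) (r : 'I_3 -> R).
Hypothesis r_gt0 : forall i, 0 < r i.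
Hypothesis c_sqr : forall i, normc (c i) ^+ 2 = 1 + r i ^+ 2.
Hypothesis apart : forall i j, i != j -> r i + r j < normc (c i - c j).
Hypothesis one_outside : forall i, r i < normc (1 - c i).
Implicit Types (z a b d : R[i]) (g h : R[i] -> R[i]) (v w : seq 'I_3).
Local Notation rho := (rho c r).
Local Notation Gamma0 := (Gamma0 c r).

Definition word_map w : R[i] -> R[i] := foldr (fun i g => rho i \o g) id w.

Lemma rhoK i : involutive (rho i).
Proof. exact: inversionK. Qed.

Lemma rho_comp i g : rho i \o (rho i \o g) = g.
Proof. by apply/funext => z /=; rewrite rhoK. Qed.

Lemma word_map_cat v w : word_map (v ++ w) = word_map v \o word_map w.
Proof. by elim: v => //= i v ->. Qed.

Lemma word_mapK w : cancel (word_map w) (word_map (rev w)).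
Proof.
elim: w => //= i w IH z.
by rewrite rev_cons -cats1 word_map_cat /= rhoK IH.
Qed.

Lemma word_map_revK w : cancel (word_map (rev w)) (word_map w).
Proof. by rewrite -{2}[w]revK; exact: word_mapK. Qed.

Lemma Gamma0_word w : Gamma0 (word_map w).
Proof.
elim: w => [|i w IH]; first exact: generated_id.
by apply: generated_comp IH; apply: generated_in; exists i.
Qed.

(** Reflections are involutions, so reversing a word inverts it and words already form a group. *)
Lemma Gamma0P g : Gamma0 g -> exists w, g = word_map w.
Proof.
elim=> [_ [i _ <-]||{}g h _ [v ->] _ [w ->]|h {}g _ [w ->] gK hK].
- by exists [:: i].
- by exists [::].
- by exists (v ++ w); rewrite word_map_cat.
- by exists (rev w); apply/funext => z; rewrite -[in RHS](hK z) word_mapK.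
Qed.

Lemma Gamma0_comp g h : Gamma0 g -> Gamma0 h -> Gamma0 (g \o h).
Proof. exact: generated_comp. Qed.

Lemma Gamma0_rho i : Gamma0 (rho i).
Proof. by apply: generated_in; exists i. Qed.

Lemma Gamma0_inverse g : Gamma0 g ->
  exists h, [/\ Gamma0 h, cancel g h & cancel h g].
Proof.
move=> /Gamma0P[w ->]; exists (word_map (rev w)).
by split; [exact: Gamma0_word | exact: word_mapK | exact: word_map_revK].
Qed.

Lemma Gamma0_disk_map g : Gamma0 g -> exists J, disk_map J g.
Proof.
move=> /Gamma0P[w ->]; elim: w => [|i w [J hJ]].
  by exists (fun=> 1); exact: disk_map_id.
by eexists; apply: disk_map_comp hJ; exact: disk_map_inversion.
Qed.

Definition reduced w := sorted (fun i j => i != j) w.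

Lemma reduce w : exists2 v, reduced v & word_map w = word_map v.
Proof.
elim: w => [|i w [v rv /= ->]]; first by exists [::].
case: v rv => [|j v] rv; first by exists [:: i].
have [->|ij] := eqVneq i j; last by exists [:: i, j & v] => //; rewrite /reduced /= ij.
by exists v; [exact: path_sorted rv | rewrite rho_comp].
Qed.

Lemma rho_inside i z : r i < normc (z - c i) -> normc (rho i z - c i) < r i.
Proof.
move=> zi; rewrite normc_inversion_center ltr_pdivrMr ?(lt_trans (r_gt0 i)) //.
by rewrite expr2 ltr_pM2l.
Qed.

Lemma outside_disc i j z : i != j -> normc (z - c j) < r j -> r i < normc (z - c i).
Proof.
move=> /apart ij zj; have := ler_normc_dist z (c i) (c j).
by rewrite (normc_dist (c i) z); lra.
Qed.

(** Ping-pong: the interior of a disc lies outside the others, so each letter, differing from the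
    one applied before it, maps the point into its own disc. *)
Lemma reduced_inside i w z : (forall k, r k < normc (z - c k)) ->
  reduced (i :: w) -> normc (word_map (i :: w) z - c i) < r i.
Proof.
move=> zout; elim: w i => [|j w IH] i /=; first by move=> _; exact: rho_inside.
by move=> /andP[ij rw]; apply/rho_inside/(outside_disc ij)/IH.
Qed.

Lemma Gamma0_inside g : Gamma0 g -> g <> id ->
  exists i, forall z, (forall k, r k < normc (z - c k)) -> normc (g z - c i) < r i.
Proof.
move=> /Gamma0P[w ->]; have [[|i v] rv ->] := reduce w; first by [].
by move=> _; exists i => z zout; exact: reduced_inside.
Qed.

Lemma Gamma0_id g : Gamma0 g -> (forall k, r k <= normc (g 1 - c k)) -> g = id.
Proof.
move=> Gg gout; apply: contrapT => gN.
have [i /(_ 1 one_outside)] := Gamma0_inside Gg gN.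
by rewrite ltNge gout.
Qed.

(** The stabilizer of 1 is trivial; this is what allows a norm to be attached to an orbit point. *)
Lemma Gamma0_inj1 g h : Gamma0 g -> Gamma0 h -> g 1 = h 1 -> g = h.
Proof.
move=> Gg Gh gh; have [h' [Gh' hK h'K]] := Gamma0_inverse Gh.
have : h' \o g = id.
  apply: Gamma0_id; first exact: Gamma0_comp.
  by move=> k; rewrite /= gh hK ltW.
by move=> e; apply/funext => z; rewrite -[LHS]h'K -[h' (g z)]/((h' \o g) z) e.
Qed.

Lemma rho1_neq1 i : rho i 1 != 1.
Proof.
by apply: contraTneq (rho_inside (one_outside i)) => ->; rewrite -leNgt ltW.
Qed.

Lemma unit_neq_center i z : normc z = 1 -> z != c i.
Proof.
move=> z1; apply: contra_eq_neq z1 => ->; rewrite -sqrp_eq1 ?normc_ge0 // c_sqr.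
by rewrite -[X in _ != X]addr0 (inj_eq (addrI 1)) sqrf_eq0 gt_eqF.
Qed.

Lemma rho_mirror i b : mirror c r i b -> rho i b = b.
Proof.
move=> bi; have bc : b - c i != 0 by rewrite -normc_eq0 bi gt_eqF.
rewrite /Defs.rho /inversion -[r i]bi sqr_normcM mulfK ?conjC_eq0 //.
by rewrite addrC subrK.
Qed.

(** The sum dominates the inverse squared distance from 1 to each disc; the initial 1 serves the
    identity, for which the point is 0. *)
Definition separation : R := 1 + \sum_k (normc (1 - c k) - r k) ^- 2.

Lemma separation_ge1 : 1 <= separation.
Proof. by rewrite lerDl sumr_ge0 // => k _; rewrite invr_ge0 sqr_ge0. Qed.

Lemma orbit0_away g : Gamma0 g -> 1 <= separation * normc (g 0 - 1) ^+ 2.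
Proof.
move=> Gg; have [->|gN] := pselect (g = id).
  rewrite sub0r normcN (ComplexField.Normc.normc1 R) expr1n mulr1.
  exact: separation_ge1.
have [i gi] := Gamma0_inside Gg gN.
have {}gi : normc (g 0 - c i) < r i.
  apply: gi => k; rewrite sub0r normcN -(ltr_pXn2r (n := 2)) ?nnegrE ?normc_ge0 ?ltW //.
  by rewrite c_sqr ltr_pwDl.
set d := normc (1 - c i) - r i; have d0 : 0 < d by rewrite subr_gt0.
have dg : d <= normc (g 0 - 1).
  have := ler_normc_dist (g 0) 1 (c i); rewrite (normc_dist 1 (g 0)) /d; lra.
apply: (@le_trans _ _ (d ^- 2 * normc (g 0 - 1) ^+ 2)).
  rewrite mulrC ler_pdivlMr ?exprn_gt0 // mul1r lerXn2r ?nnegrE ?normc_ge0 //.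
  exact: ltW.
rewrite ler_wpM2r ?sqr_ge0 // /separation (bigD1 i) //= -/d.
rewrite addrCA lerDl addr_ge0 // sumr_ge0 // => k _.
by rewrite invr_ge0 sqr_ge0.
Qed.

(* The reflection in mirror j exchanges 1 with rho j 1 and preserves the arc
   between them, which therefore meets the orbit of 1 only at its endpoints. *)
Lemma orbit_gap (e : bool) j b : normc b = 1 -> mirror c r j b ->
  (forall z, normc z = 1 -> 0 < (-1) ^+ e * orient 1 z b ->
     forall k, r k <= normc (z - c k)) ->
  forall g, Gamma0 g ->
    [\/ g = id, g = rho j | 0 < (-1) ^+ e * orient 1 (rho j 1) (g 1)].
Proof.
move=> b1 bj hb g Gg.
have [->|gN] := pselect (g = id); first by constructor 1.
have [->|gNj] := pselect (g = rho j); first by constructor 2.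
constructor 3; rewrite ltNge; apply/negP => le0.
have n1 : normc (1 : R[i]) = 1 by exact: ComplexField.Normc.normc1.
have hj := disk_map_inversion (r_gt0 j) (c_sqr j).
have [J hg] := Gamma0_disk_map Gg.
have g1 := disk_map_eq1 hg n1; have u1 : normc (rho j 1) = 1 := disk_map_eq1 hj n1.
have Gjg : Gamma0 (rho j \o g) by apply: Gamma0_comp => //; exact: Gamma0_rho.
have jgN : rho j \o g <> id.
  by move=> h; apply: gNj; rewrite -[g](rho_comp j) h.
have not_out h : Gamma0 h -> h <> id -> normc (h 1) = 1 ->
    ~~ (0 < (-1) ^+ e * orient 1 (h 1) b).
  move=> Gh hN h1; apply/negP => hb0; apply: hN; apply: Gamma0_id => //.
  exact: hb.
have gu : g 1 != rho j 1.
  by apply/eqP => h; apply: gNj; apply: Gamma0_inj1 => //; exact: Gamma0_rho.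
have gN1 : g 1 != 1.
  by apply/eqP => h; apply: gN; apply: Gamma0_inj1 => //; exact: generated_id.
have gb : g 1 != b.
  (* [b] is fixed by [rho j], so [rho j \o g] and [g] agree at 1, hence everywhere; but [rho j]
     moves 1. *)
  apply/eqP => h; have : rho j \o g = g.
    by apply: Gamma0_inj1; rewrite //= h rho_mirror.
  move=> jg; have [h' [_ _ h'K]] := Gamma0_inverse Gg.
  have := rho1_neq1 j; rewrite -[1]h'K.
  by rewrite -[X in X != _]/((rho j \o g) (h' 1)) jg eqxx.
have b_neq1 : b != 1.
  by apply: contraTneq (one_outside j) => <-; rewrite bj ltxx.
have sgn_gt0 (x : R) :
    x != 0 -> ~~ (0 < (-1) ^+ e * x) -> 0 < (-1) ^+ e * - x.
  move=> x0; rewrite -leNgt => h.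
  by rewrite mulrN oppr_gt0 lt_neqAle h mulf_neq0 ?signr_eq0.
have o1 : 0 < (-1) ^+ e * orient 1 (g 1) (rho j 1).
  rewrite orient_swap; apply: sgn_gt0; last by rewrite -leNgt.
  by apply: orient_neq0; rewrite // 1?eq_sym // rho1_neq1.
have o2 : 0 < (-1) ^+ e * orient 1 b (g 1).
  rewrite orient_swap; apply: sgn_gt0; last exact: not_out.
  by apply: orient_neq0; rewrite // eq_sym.
(* In the direction given by [e], the order is 1, [b], [g 1], [rho j 1]. Reflecting puts
   [rho j (g 1)] between 1 and [b], where [not_out] forbids it. *)
have o3 : 0 < (-1) ^+ e * orient b (g 1) (rho j 1).
  case: e o1 o2 {hb le0 not_out sgn_gt0} => /=.
    rewrite !expr1 !mulN1r -!orient_swap => o1 o2.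
    rewrite orient_rot; apply: (@orient_gt0_trans _ _ _ 1) => //.
      by rewrite orient_rot.
    by rewrite -orient_rot.
  rewrite !expr0 !mul1r => o1 o2.
  rewrite -orient_rot; apply: (@orient_gt0_trans _ _ _ 1) => //.
    by rewrite orient_rot.
  by rewrite -orient_rot.
have jg1 := disk_map_eq1 hj g1.
have := not_out _ Gjg jgN jg1; rewrite -leNgt; apply/negP; rewrite -ltNge.
have := orient_inversion (c_sqr j) (unit_neq_center j b1)
  (unit_neq_center j g1) (unit_neq_center j u1) b1 g1 u1.
rewrite -/(rho j) (rho_mirror bj) rhoK => o4.
rewrite orient_swap -orient_rot [orient _ _ _]o4 opprK mulrCA mulr_gt0 //.
have pos z : normc z = 1 -> 0 < r j ^+ 2 / normc (z - c j) ^+ 2.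
  by move=> z1; apply: (disk_map_gt0 hj); rewrite z1.
by apply: mulr_gt0; [apply: mulr_gt0|]; apply: pos.
Qed.

(** If [g] reverses orientation it exchanges the two directions, so the mirror is read off at
    [e (+) f], where [f] is the orientation of [g]. *)
Lemma orbit_gap_translate (nxt : bool -> 'I_3) :
  (forall e g, Gamma0 g ->
    [\/ g = id, g = rho (nxt e) | 0 < (-1) ^+ e * orient 1 (rho (nxt e) 1) (g 1)]) ->
  forall (e : bool) g, Gamma0 g -> exists j, forall h, Gamma0 h ->
    [\/ h = g, h = g \o rho j | 0 < (-1) ^+ e * orient (g 1) (g (rho j 1)) (h 1)].
Proof.
move=> gap e g Gg; have [J hg] := Gamma0_disk_map Gg.
have [f hf] := disk_map_orient hg; exists (nxt (e (+) f)) => h Gh.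
have n1 : normc (1 : R[i]) = 1 by exact: ComplexField.Normc.normc1.
have [g' [Gg' _ g'K]] := Gamma0_inverse Gg.
set j := nxt _; have hj := disk_map_inversion (r_gt0 j) (c_sqr j).
have Gk : Gamma0 (g' \o h) by exact: Gamma0_comp.
have ghE : g \o (g' \o h) = h by apply/funext => z /=; rewrite g'K.
have [J' hk] := Gamma0_disk_map Gk.
have k1 := disk_map_eq1 hk n1.
have u1 : normc (rho j 1) = 1 := disk_map_eq1 hj n1.
have [e1|e2|e3] := gap (e (+) f) _ Gk.
- by constructor 1; rewrite -ghE e1.
- by constructor 2; rewrite -[in LHS]ghE e2.
constructor 3; rewrite -ghE.
rewrite -[(g \o _) 1]/(g ((g' \o h) 1)) hf // mulrA mulrA -signr_addb -mulrAC.
rewrite mulr_gt0 //.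
by rewrite !mulr_gt0 // (disk_map_gt0 hg) // ?n1 ?u1 ?k1.
Qed.

End Reflections.

(** * Consequences of the principal configuration *)

Section Configuration.
Context {R : realType}.
Variables (c : 'I_3 -> R[i]) (r : 'I_3 -> R) (F : set R[i]).
Hypothesis hF : principal_configuration c r F.

Lemma center_sqr i : normc (c i) ^+ 2 = 1 + r i ^+ 2.
Proof. exact/orthogonal_unit_circle/(mirrors_orthogonal hF). Qed.

Lemma region_unit_disk z : F z -> normc z < 1.
Proof.
have [[x _ ->] _] := region_bounded hF.
by move=> /connected_component_sub[].
Qed.

(** The derivative of the inversion has modulus [r ^+ 2 / normc (z - c) ^+ 2], so the principal
    condition compares radius and distance. *)
Lemma region_outside i z : F z -> r i <= normc (z - c i).
Proof.
move=> Fz; have := principal_region hF i Fz.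
have zc : z != c i.
  apply: contraTneq (region_unit_disk Fz) => ->; rewrite -leNgt.
  by rewrite -(expr_ge1 (n := 2)) ?normc_ge0 // center_sqr lerDl sqr_ge0.
have d0 : 0 < normc (z - c i).
  by rewrite lt0r normc_ge0 normc_eq0 subr_eq0 zc.
rewrite abs_deriv_inversion // ler_pdivrMr ?exprn_gt0 // mul1r.
by rewrite ler_pXn2r ?nnegrE ?normc_ge0 // ltW // (radii_gt0 hF).
Qed.

Lemma discs_disjoint i j : i != j -> r i + r j < normc (c i - c j).
Proof.
move=> ij; apply: discs_apart; rewrite ?center_sqr ?(radii_gt0 hF) //.
  exact: mirrors_disjoint hF _ _ ij.
move=> z z1 zi zj; have := minor_sides_apart hF ij; rewrite ltNge => /negP; apply.
exact: (@edist_le0 _ _ _ z).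
Qed.

(* p e is the end of the free arc met first from 1 when going counterclockwise
   (e = false) or clockwise (e = true). *)
Lemma gaps_at_one : exists (p : bool -> R[i]) (nxt : bool -> 'I_3), forall e,
  [/\ normc (p e) = 1, mirror c r (nxt e) (p e) &
      forall z, normc z = 1 -> 0 < (-1) ^+ e * orient 1 z (p e) ->
        forall k, r k <= normc (z - c k)].
Proof.
have [A [a [b [[]]]]] := one_in_free_arc hF.
rewrite /unit_circle /circle /= !subr0 => a1 b1 ab AE _ Acl A1.
have anb : a != b.
  have := mirrors_disjoint hF (i := ord0) (j := ord_max) isT.
  by move=> e; apply/eqP => h; case: ab; rewrite h => -[h1 h2];
    have : set0 b by rewrite -e.
have n1 : normc (1 : R[i]) = 1 by exact: ComplexField.Normc.normc1.
move: A1; rewrite AE => /ccw_arcP[] // _ o1.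
(* The free arc lies in the closure of [F], and being outside an open disc is a closed condition. *)
have out z : normc z = 1 -> 0 < orient a z b -> forall k, r k <= normc (z - c k).
  move=> z1 oz k; apply: (@closure_outside _ F); first exact: region_outside.
  by apply: Acl; rewrite AE; apply/ccw_arcP.
have [i [j [ai bj]]] : exists i j, mirror c r i a /\ mirror c r j b.
  by case: ab => -[? ?]; [exists ord0, ord_max | exists ord_max, ord0].
exists (fun e : bool => if e then a else b), (fun e : bool => if e then i else j).
case; split=> // z z1; rewrite ?expr1 ?expr0 ?mulN1r ?mul1r => oz; apply: out => //.
  apply: (@orient_gt0_trans _ _ _ 1) => //.
  by rewrite -orient_rot orient_swap -orient_rot -orient_rot.
rewrite -orient_rot -orient_rot; apply: (@orient_gt0_trans _ _ _ 1) => //.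
  by rewrite -orient_rot.
by rewrite -orient_rot.
Qed.

(** Closure only yields a weak inequality; it is strict because the free arc avoids the mirrors. *)
Lemma one_outside i : r i < normc (1 - c i).
Proof.
have [A [a [b [[ha hb] _ AE Am Acl]]] A1] := one_in_free_arc hF.
rewrite lt_neqAle; apply/andP; split.
  apply/eqP => h; have : set0 (1 : R[i]) by rewrite -Am; split => //; exists i.
  by [].
apply: (@closure_outside _ F); first exact: region_outside.
exact: Acl.
Qed.

Lemma admissible_radius_lt1 r0 : admissible_radius c r F r0 -> 0 < r0 < 1.
Proof.
move=> [r00 sub _]; rewrite r00 /=.
(* The point of the horocycle opposite to 1. *)
have [|/region_unit_disk|] := sub (1 - r0 - r0)%:C.
- rewrite /horocycle /circle /= !subr0 expr0n addr0 sqrtr_sqr.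
  by rewrite addrAC subrr add0r normrN gtr0_norm.
- by rewrite normc_real ltr_norml => /andP[]; lra.
by move=> /(congr1 (@complex.Re R)) /=; lra.
Qed.

End Configuration.

(** * The uniform constant and the comparison of neighbors *)

Unset Implicit Arguments.

Theorem theorem4p2 (R : realType) (c : 'I_3 -> R[i]) (r : 'I_3 -> R)
    (F : set R[i]) (r0 : R)
    (hF : principal_configuration c r F) (hr0 : admissible_radius c r F r0) :
  exists2 B : R, 1 <= B &
    forall (T : R) (g1 g2 : R[i] -> R[i]),
      Gamma0 c r g1 -> Gamma0 c r g2 ->
      neighbors (orbit_below c r r0 T) (g1 1) (g2 1) ->
      1 / B * horo_norm r0 g2 <= horo_norm r0 g1 <= B * horo_norm r0 g2.
Proof.
have r01 := admissible_radius_lt1 hF hr0.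
have rgt := radii_gt0 hF; have csq := center_sqr hF.
have apt := discs_disjoint hF; have out1 := one_outside hF.
have n1 : normc (1 : R[i]) = 1 by exact: ComplexField.Normc.normc1.
pose lam i : R := 4 * separation c r / (r i ^+ 2 / normc (1 - c i) ^+ 2).
have E0 : 0 <= separation c r by apply: le_trans (separation_ge1 c r).
have lam0 i : 0 <= lam i.
  by apply: divr_ge0; [apply: mulr_ge0 | apply: divr_ge0; apply: sqr_ge0].
(* The sum bounds the factors of all three reflections at once; the added 1 gives [1 <= B]. *)
pose B := Num.sqrt (1 + \sum_i lam i).
have B1 : 1 <= B.
  by rewrite -[X in X <= _]sqrtr1 ler_wsqrtr // lerDl sumr_ge0.
have norm_comp g i : Gamma0 c r g -> horo_norm r0 (g \o rho c r i) <= B * horo_norm r0 g.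
  move=> Gg; have [h [Gh gK hK]] := Gamma0_inverse rgt Gg.
  have [J hJ] := Gamma0_disk_map rgt csq Gg.
  have [K hK'] := Gamma0_disk_map rgt csq Gh.
  have hi := disk_map_inversion (rgt i) (csq i).
  have sep := orbit0_away rgt csq apt out1 Gh.
  have /le_trans := horo_norm_comp_le r01 hJ hK' hK hi hi (rhoK c rgt i) E0 sep.
  apply; rewrite -/(lam i).
  rewrite ler_wpM2r ?sqrtr_ge0 // ler_wsqrtr // lerD2l (bigD1 i) //= lerDl.
  by rewrite sumr_ge0.
have norm_ge0 g : 0 <= horo_norm r0 g by exact: sqrtr_ge0.
have norm_le g : horo_norm r0 g <= B * horo_norm r0 g by rewrite ler_peMl.
have [p [nxt gaps]] := gaps_at_one hF.
have next := orbit_gap_translate rgt csq (nxt := nxt)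
  (fun e => let: And3 p1 pm po := gaps e in orbit_gap rgt csq apt out1 p1 pm po).
have unit g : Gamma0 c r g -> normc (g 1) = 1.
  by move=> /(Gamma0_disk_map rgt csq)[J /disk_map_eq1]; apply.
(* Membership provides some element of small norm with the same value at 1; [Gamma0_inj1] identifies
   it with [g]. *)
have below T g : Gamma0 c r g -> orbit_below c r r0 T (g 1) -> horo_norm r0 g < T.
  by move=> Gg [h [Gh hT] /(Gamma0_inj1 rgt apt out1 Gh Gg) <-].
have arc_le T g h : Gamma0 c r g -> Gamma0 c r h ->
    horo_norm r0 g < T -> horo_norm r0 h < T ->
    ccw_arc (g 1) (h 1) `&` orbit_below c r r0 T = set0 ->
    horo_norm r0 g <= B * horo_norm r0 h /\ horo_norm r0 h <= B * horo_norm r0 g.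
  move=> Gg Gh gT hT arc0.
  (* An orbit point inside the empty arc cannot be below level [T]. Positive orientation also
     excludes equal ends. *)
  have key k i : Gamma0 c r k ->
      0 < orient (g 1) (k (rho c r i 1)) (h 1) -> T <= horo_norm r0 (k \o rho c r i).
    move=> Gk o; rewrite leNgt; apply/negP => kT.
    have Gki : Gamma0 c r (k \o rho c r i).
      by apply: Gamma0_comp => //; exact: Gamma0_rho.
    have gh : g 1 != h 1.
      apply: contraTneq o => ->; rewrite -orient_rot -orient_rot orient_id ltxx //.
    have : set0 (k (rho c r i 1)); last by [].
    rewrite -arc0; split; last by exists (k \o rho c r i).
    by apply/ccw_arcP; rewrite ?unit //; split=> //; exact: (unit _ Gki).
  (* The first bound looks clockwise from [h 1], the second counterclockwise from [g 1]. *)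
  split.
    have [j /(_ g Gg)[->|->|]] := next true h Gh; [exact: norm_le|exact: norm_comp|].
    rewrite expr1 mulN1r -orient_swap -orient_rot => /(key h j Gh) Tle.
    by rewrite (le_trans (ltW gT)) // (le_trans Tle) // norm_comp.
  have [j /(_ h Gh)[->|->|]] := next false g Gg; [exact: norm_le|exact: norm_comp|].
  rewrite expr0 mul1r => /(key g j Gg) Tle.
  by rewrite (le_trans (ltW hT)) // (le_trans Tle) // norm_comp.
exists B => // T g1 g2 G1 G2 [A1 A2 arcs].
have [le12 le21] : horo_norm r0 g1 <= B * horo_norm r0 g2 /\
    horo_norm r0 g2 <= B * horo_norm r0 g1.
  have [T1 T2] := (below T g1 G1 A1, below T g2 G2 A2).
  case: arcs => /arc_le arc; first exact: arc.
  by have [] := arc G2 G1 T2 T1.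
by rewrite le12 andbT mulrC mulrA mulr1 ler_pdivrMr ?(lt_le_trans ltr01) // mulrC.
Qed.
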